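(* Let $L$ be a lattice, let $S$ be a reflexive weak ordered relation on $L$, and let $T$ be a tolerance of $L$. Then: (i) $S$ includes $\leq$, and ${\leq}\circ S^{-1}=S^{-1}\circ{\leq}=L\times L$; (ii) ${\leq}\circ T\circ{\leq}$ is a reflexive weak ordered relation on $L$; (iii) $T=\left({\leq}\circ T\circ{\leq}\right)\cap\left({\geq}\circ T\circ{\geq}\right)$.
   Context: Binary relations are composed by: $(x,y)\in R\circ S$ iff there is $z$ with $(x,z)\in R$ and $(z,y)\in S$; $R^{-1}$ is the inverse relation; $\leq$ is the order of $L$ and $\geq$ its inverse. A binary relation on a lattice $L$ is compatible if it is a sublattice of $L^2=L\times L$. A tolerance of $L$ is a reflexive, symmetric, compatible relation $T\subseteq L^2$. A binary relation $R$ on a lattice $L$ is a weak ordered relation if: (1) for any $u,x,y,z\in L$, $u\leq x$, $(x,y)\in R$ and $y\leq z$ imply $(u,z)\in R$; (2) for any $t\in L$ and any nonempty finite $A\subseteq L$, if $(a,t)\in R$ for each $a\in A$ then $\left(\bigvee A,t\right)\in R$; (3) for any $z\in L$ and any nonempty finite $A\subseteq L$, if $(z,a)\in R$ for each $a\in A$ then $\left(z,\bigwedge A\right)\in R$. *)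

(* Defs.v *)
From mathcomp Require Import all_boot all_order.
From mathcomp Require Import boolp classical_sets cardinality.
Set Implicit Arguments.
Unset Strict Implicit.
Unset Printing Implicit Defensive.

Local Open Scope classical_set_scope.
Local Open Scope order_scope.

Section Relations.
Context {d : Order.disp_t} {L : latticeType d}.
Implicit Types R S T : set (L * L).

(* [relcomp R S] is the composition "first R, then S", that is, (x, y) is in
   [relcomp R S] iff (x, z) is in R and (z, y) is in S for some z. The library
   notation [\;] takes its arguments in the opposite order. *)
Definition relcomp R S : set (L * L) := (S \; R)%relation.

Definition relinv R : set (L * L) := (R^-1)%relation.

Definition le_rel : set (L * L) := [set xy | xy.1 <= xy.2].

Definition ge_rel : set (L * L) := relinv le_rel.

Definition rel_reflexive R : Prop := forall x, R (x, x).

Definition rel_symmetric R : Prop := forall x y, R (x, y) -> R (y, x).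

(* [L *p L] is the direct square of L, with componentwise meet and join. *)
Definition compatible R : Prop :=
  @Order.ClosedPredicates.meet_closed _ (L *p L)%type (mem R) /\
  @Order.ClosedPredicates.join_closed _ (L *p L)%type (mem R).

Definition tolerance T : Prop :=
  [/\ rel_reflexive T, rel_symmetric T & compatible T].

(* In a lattice, [supremums A] and [infimums A] are singletons when A is finite
   and nonempty; their elements are the join and the meet of A. *)
Definition weak_ordered R : Prop :=
  [/\ forall u x y z : L, u <= x -> R (x, y) -> y <= z -> R (u, z),
      forall (t : L) (A : set L), finite_set A -> A !=set0 ->
        (forall a, A a -> R (a, t)) ->
        forall s, supremums A s -> R (s, t)
    & forall (z : L) (A : set L), finite_set A -> A !=set0 ->
        (forall a, A a -> R (z, a)) ->
        forall m, infimums A m -> R (z, m)].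

End Relations.

(* Main.v *)
Require Import Defs.
From mathcomp Require Import all_boot all_order.
From mathcomp Require Import boolp classical_sets cardinality.
Local Open Scope classical_set_scope.

Set Implicit Arguments.
Unset Strict Implicit.
Unset Printing Implicit Defensive.

Import Order.TTheory.

Section Relations.
Local Open Scope order_scope.
Context {d : Order.disp_t} {L : latticeType d}.
Implicit Types (R S T : set (L * L)) (x y z t : L).

(** For (i), reflexivity and monotonicity put [le_rel] inside [S]; then any x and y are linked
    through their join, or through their meet when the factors are swapped. For (ii), compatibility
    of [T] makes the elements related to a fixed t closed downwards and under binary joins, and
    dually on the other side; [ideal_supremum] and [filter_infimum] pass from binary to finite
    nonempty joins and meets. For (iii), [compatible_eq_le_ge] writes a pair of the intersection as
    a lattice polynomial in two pairs of [T] and two diagonal pairs. *)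

Lemma relcompE R S x y :
  relcomp R S (x, y) <-> exists2 z, R (x, z) & S (z, y).
Proof. by split=> -[z]; exists z. Qed.

Lemma le_comp_leE T x y :
  relcomp (relcomp le_rel T) le_rel (x, y) <->
  exists a b, [/\ x <= a, T (a, b) & b <= y].
Proof.
split=> [/relcompE[b /relcompE[a xa Tab] b_y]|[a [b [xa Tab b_y]]]].
  by exists a, b.
by apply/relcompE; exists b => //; apply/relcompE; exists a.
Qed.

Lemma ge_comp_geE T x y :
  relcomp (relcomp ge_rel T) ge_rel (x, y) <->
  exists a b, [/\ a <= x, T (a, b) & y <= b].
Proof.
split=> [/relcompE[b /relcompE[a xa Tab] b_y]|[a [b [xa Tab b_y]]]].
  by exists a, b.
by apply/relcompE; exists b => //; apply/relcompE; exists a.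
Qed.

Lemma compatible_meet R x y x' y' :
  compatible R -> R (x, y) -> R (x', y') -> R (x `&` x', y `&` y').
Proof.
case=> RI _ /mem_set Rxy /mem_set Rxy'.
exact/set_mem/(RI (x, y) (x', y') Rxy Rxy').
Qed.

Lemma compatible_join R x y x' y' :
  compatible R -> R (x, y) -> R (x', y') -> R (x `|` x', y `|` y').
Proof.
case=> _ RU /mem_set Rxy /mem_set Rxy'.
exact/set_mem/(RU (x, y) (x', y') Rxy Rxy').
Qed.

Lemma weak_ordered_le R :
  rel_reflexive R -> weak_ordered R -> le_rel `<=` R.
Proof. by move=> Rxx [Rle _ _] [x y] xy; apply: Rle (lexx x) (Rxx x) xy. Qed.

Lemma le_comp_relinv R : le_rel `<=` R -> relcomp le_rel (relinv R) = setT.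
Proof.
move=> leR; apply/seteqP; split=> // -[x y] _.
by apply/relcompE; exists (x `|` y); [exact: leUl | apply: leR; exact: leUr].
Qed.

Lemma relinv_comp_le R : le_rel `<=` R -> relcomp (relinv R) le_rel = setT.
Proof.
move=> leR; apply/seteqP; split=> // -[x y] _.
by apply/relcompE; exists (x `&` y); [apply: leR; exact: leIl | exact: leIr].
Qed.

(** Joining the elements of [A] one by one gives an upper bound of [A] inside [I]; the supremum lies
    below it, so downward closure puts it in [I]. *)
Lemma ideal_supremum (I A : set L) s :
  (forall x y, x <= y -> I y -> I x) ->
  (forall x y, I x -> I y -> I (x `|` y)) ->
  finite_set A -> A !=set0 -> A `<=` I -> supremums A s -> I s.
Proof.
move=> Ile IU /finite_seqP[r ->] [x0 rx0] rI [_ sleast].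
suff [u [Iu ru]] : exists u, I u /\ (forall x, x \in r -> x <= u).
  by apply: Ile Iu; apply: sleast.
(* [L] may lack a bottom, so [x0] serves as the bound of the empty list. Only its membership in [I]
   survives the induction on [r]. *)
have {rx0} Ix0 := rI _ rx0.
elim: r rI {sleast} => [|a r IH] rI; first by exists x0.
have [x rx|u [Iu ru]] := IH; first by apply: rI; rewrite /= inE rx orbT.
exists (a `|` u); split; first by apply: IU Iu; apply: rI; rewrite /= mem_head.
by move=> x; rewrite inE => /predU1P[->|/ru]; [exact: leUl | exact: lexUr].
Qed.

End Relations.

(** A filter of [L] is an ideal of the dual lattice [L^d], where infima become suprema. *)
Lemma filter_infimum {d : Order.disp_t} {L : latticeType d} (F A : set L) m :
  (forall x y, (x <= y)%O -> F x -> F y) ->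
  (forall x y, F x -> F y -> F (x `&` y)%O) ->
  finite_set A -> A !=set0 -> A `<=` F -> infimums A m -> F m.
Proof.
move=> Fle FI Afin A0 AF Am.
by apply: (@ideal_supremum _ L^d F A m) => // x y yx; apply: Fle.
Qed.

Section Tolerances.
Local Open Scope order_scope.
Context {d : Order.disp_t} {L : latticeType d} (T : set (L * L)).

Lemma le_comp_le_reflexive :
  rel_reflexive T -> rel_reflexive (relcomp (relcomp le_rel T) le_rel).
Proof. by move=> Txx x; apply/le_comp_leE; exists x, x. Qed.

Lemma le_comp_le_weak_ordered :
  compatible T -> weak_ordered (relcomp (relcomp le_rel T) le_rel).
Proof.
move=> Tcomp.
have Rle u x y z : u <= x -> relcomp (relcomp le_rel T) le_rel (x, y) ->
    y <= z -> relcomp (relcomp le_rel T) le_rel (u, z).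
  move=> ux /le_comp_leE[a [b [xa Tab b_y]]] yz; apply/le_comp_leE.
  by exists a, b; split=> //; [exact: le_trans xa | exact: le_trans yz].
split=> // [t A Afin A0 AR s|z A Afin A0 AR m].
(* Witnesses for a join are the joins of the witnesses; the second one stays below [t] because both
   of its terms do. *)
- pose I := [set x | relcomp (relcomp le_rel T) le_rel (x, t)].
  apply: (ideal_supremum (I := I) _ _ Afin A0 AR) => /= [x y xy Ryt|x y];
    first exact: Rle xy Ryt (lexx t).
  move=> /le_comp_leE[a [b [xa Tab bt]]] /le_comp_leE[a' [b' [ya Tab' bt']]].
  apply/le_comp_leE; exists (a `|` a'), (b `|` b').
  by split; [exact: leU2 | exact: compatible_join | rewrite leUx bt].
- pose F := [set x | relcomp (relcomp le_rel T) le_rel (z, x)].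
  apply: (filter_infimum (F := F) _ _ Afin A0 AR) => /= [x y xy Rzx|x y];
    first exact: Rle (lexx z) Rzx xy.
  move=> /le_comp_leE[a [b [za Tab bx]]] /le_comp_leE[a' [b' [za' Tab' b_y]]].
  apply/le_comp_leE; exists (a `&` a'), (b `&` b').
  by split; [rewrite lexI za | exact: compatible_meet | exact: leI2].
Qed.

(* If [x <= a], [b <= y], [c <= x] and [y <= e] with [(a, b)] and [(c, e)] in
   [T], then [(x, y)] is the join of [(x, x) `&` (a, b)] and
   [(c, e) `&` (y, y)]. *)
Lemma compatible_eq_le_ge : rel_reflexive T -> compatible T ->
  T = (relcomp (relcomp le_rel T) le_rel `&`
       relcomp (relcomp ge_rel T) ge_rel)%classic.
Proof.
move=> Txx Tcomp; apply/seteqP; split=> [[x y] Txy|[x y] []].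
  by split; [apply/le_comp_leE | apply/ge_comp_geE]; exists x, y.
move=> /le_comp_leE[a [b [xa Tab b_y]]] /ge_comp_geE[c [e [cx Tce ye]]].
have Txb := compatible_meet Tcomp (Txx x) Tab.
have Tcy := compatible_meet Tcomp Tce (Txx y).
have := compatible_join Tcomp Txb Tcy.
(* What remains is absorption: the meet of c and y is below c, hence below x, and the meet of x and
   b is below b, hence below y. *)
rewrite (meet_idPl xa) (meet_idPr ye).
have /join_idPl -> : c `&` y <= x by exact: leIxl.
by have /join_idPr -> : x `&` b <= y by exact: leIxr.
Qed.

End Tolerances.

Theorem lemma2p5 (d : Order.disp_t) (L : latticeType d) (S T : set (L * L))
    (Srefl : rel_reflexive S) (Sweak : weak_ordered S) (Ttol : tolerance T) :
  [/\ [/\ le_rel `<=` S,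
          relcomp le_rel (relinv S) = relcomp (relinv S) le_rel
        & relcomp (relinv S) le_rel = [set: L * L]],
      rel_reflexive (relcomp (relcomp le_rel T) le_rel) /\
      weak_ordered (relcomp (relcomp le_rel T) le_rel)
    & T = relcomp (relcomp le_rel T) le_rel `&`
          relcomp (relcomp ge_rel T) ge_rel].
Proof.
have [Txx _ Tcomp] := Ttol.
have leS := weak_ordered_le Srefl Sweak.
split.
- split=> //; last exact: relinv_comp_le.
  by rewrite le_comp_relinv // relinv_comp_le.
- by split; [exact: le_comp_le_reflexive | exact: le_comp_le_weak_ordered].
- exact: compatible_eq_le_ge.
Qed.
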